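(* (The rectangle theorem) Let $\widehat G$ be a finite index subgroup of $\widehat U$ generated by rotations, and suppose that $\widehat G$ contains a rotation with axis parallel to the $x$-axis and a rotation with axis parallel to the $y$-axis. Let $\mathcal P$ be a plane parallel to the $yz$-plane that contains an axis of rotation of $\widehat G$ parallel to the $y$-axis. Call a point of $\mathcal P$ an axis point if it is the intersection of $\mathcal P$ with an axis of rotation of $\widehat G$ parallel to the $x$-axis. Then there is a tessellation of $\mathcal P$ by congruent rectangles with sides parallel to the $y$- and $z$-axes such that the set of axis points equals the set of vertices of the rectangles. Each rectangle is divided in half by an axis of rotation of $\widehat G$ parallel to the $y$-axis.
   Context: $\widehat U$ is the group of isometries of Euclidean space $E^3=\mathbb R^3$ generated by the $180^\circ$ rotations about the lines $\{(t,0,1)\}$, $\{(1,t,0)\}$, $\{(0,1,t)\}$ ($t\in\mathbb R$), i.e. by $(x,y,z)\mapsto(x,-y,2-z)$, $(x,y,z)\mapsto(2-x,y,-z)$, $(x,y,z)\mapsto(-x,2-y,z)$. A rotation is a non-identity element fixing some line (its axis) pointwise; an axis of rotation of a subgroup of $\widehat U$ is the axis of a rotation in that subgroup. All rotations in $\widehat U$ are by $180^\circ$, and the axes of rotation of $\widehat U$ are exactly the lines $(t,\text{even},\text{odd})$, $(\text{odd},t,\text{even})$, $(\text{even},\text{odd},t)$, $t\in\mathbb R$. A subgroup is generated by rotations if it is generated by the rotations it contains. The tessellation is the usual edge-to-edge one, by translates of a single rectangle under the lattice generated by its side vectors. *)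

(* Defs.v *)
From HB Require Import structures.
From mathcomp Require Import all_boot all_order all_algebra.
From mathcomp Require Import boolp classical_sets functions cardinality reals.

Set Implicit Arguments.
Unset Strict Implicit.
Unset Printing Implicit Defensive.

Import Order.TTheory GRing.Theory Num.Theory.

Local Open Scope classical_set_scope.
Local Open Scope ring_scope.

(* The coordinates of p : E3 R are x = p 0 0, y = p 0 1 and z = p 0 2. *)
Notation E3 R := 'rV[R]_3.

Section Euclidean.
Variable R : realType.
Implicit Types (p q v : E3 R) (L : set (E3 R)).

Definition pt3 (x y z : R) : E3 R := \row_(i < 3) [:: x; y; z]`_i.

Definition ex : E3 R := pt3 1 0 0.
Definition ey : E3 R := pt3 0 1 0.
Definition ez : E3 R := pt3 0 0 1.

(* The library norm on row vectors is the sup norm, hence this definition. *)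
Definition edist p q : R := Num.sqrt (\sum_(i < 3) (p 0 i - q 0 i) ^+ 2).

Definition is_isometry (f : E3 R -> E3 R) : Prop :=
  bijective f /\ forall p q, edist (f p) (f q) = edist p q.

Record isom := Isom {
  isom_fun :> E3 R -> E3 R;
  isomP : `[< is_isometry isom_fun >]
}.

HB.instance Definition _ := [isSub for isom_fun].
HB.instance Definition _ := [Choice of isom by <:].

Lemma isom_ext (f g : isom) : f =1 g -> f = g.
Proof. by move=> fg; apply/val_inj/funext. Qed.

Lemma isom_subproof (f : E3 R -> E3 R) : is_isometry f -> `[< is_isometry f >].
Proof. by move/asboolP. Qed.

Lemma isometry_id : is_isometry id.
Proof. by split=> //; exists id. Qed.

Lemma isometry_comp (f g : E3 R -> E3 R) :
  is_isometry f -> is_isometry g -> is_isometry (f \o g).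
Proof.
move=> [bf df] [bg dg]; split; first exact: bij_comp.
by move=> p q /=; rewrite df dg.
Qed.

Lemma isom_inv_subproof (f : isom) :
  {g : E3 R -> E3 R | [/\ cancel f g, cancel g f & is_isometry g]}.
Proof.
have [bf df] := asboolW (isomP f).
apply: cid; have [g fK gK] := bf.
exists g; split=> //; split; first by exists f.
by move=> p q; rewrite -df !gK.
Qed.

Definition isom_one : isom := Isom (isom_subproof isometry_id).
Definition isom_mul (f g : isom) : isom :=
  Isom (isom_subproof (isometry_comp (asboolW (isomP f)) (asboolW (isomP g)))).
Definition isom_inv (f : isom) : isom :=
  let: And3 _ _ h := svalP (isom_inv_subproof f) in Isom (isom_subproof h).

Lemma isom_mulA : associative isom_mul.
Proof. by move=> f g h; apply: isom_ext. Qed.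

Lemma isom_mul1l : left_id isom_one isom_mul.
Proof. by move=> f; apply: isom_ext. Qed.

Lemma isom_mul1r : right_id isom_one isom_mul.
Proof. by move=> f; apply: isom_ext. Qed.

Lemma isom_mulVl : left_inverse isom_one isom_inv isom_mul.
Proof.
move=> f; apply: isom_ext => p; rewrite /isom_inv.
by case: (svalP (isom_inv_subproof f)) => fK gK h /=; rewrite fK.
Qed.

Lemma isom_mulVr : right_inverse isom_one isom_inv isom_mul.
Proof.
move=> f; apply: isom_ext => p; rewrite /isom_inv.
by case: (svalP (isom_inv_subproof f)) => fK gK h /=; rewrite gK.
Qed.

(* The group of isometries of E3; (f * g)%g is the map f \o g. *)
HB.instance Definition _ := isGroup.Build isom
  isom_mulA isom_mul1l isom_mul1r isom_mulVl isom_mulVr.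

Lemma isom1E p : (1%g : isom) p = p.
Proof. by []. Qed.

Lemma isomME (f g : isom) p : (f * g)%g p = f (g p).
Proof. by []. Qed.

Definition half_turn_x p := pt3 (p 0 0) (- p 0 1) (2 - p 0 2).
Definition half_turn_y p := pt3 (2 - p 0 0) (p 0 1) (- p 0 2).
Definition half_turn_z p := pt3 (- p 0 0) (2 - p 0 1) (p 0 2).

Lemma row3P p q : p 0 0 = q 0 0 -> p 0 1 = q 0 1 -> p 0 2 = q 0 2 -> p = q.
Proof.
move=> e0 e1 e2; apply/rowP; case=> [[|[|[|//]]] lti].
- by rewrite (_ : Ordinal lti = 0) //; apply: val_inj.
- by rewrite (_ : Ordinal lti = 1) //; apply: val_inj.
- by rewrite (_ : Ordinal lti = 2) //; apply: val_inj.
Qed.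

Lemma half_turn_isometry (f : E3 R -> E3 R) : involutive f ->
    (forall p q (i : 'I_3),
       (f p 0 i - f q 0 i) ^+ 2 = (p 0 i - q 0 i) ^+ 2) ->
  is_isometry f.
Proof.
move=> fK fd; split; first by exists f.
by move=> p q; rewrite /edist; congr Num.sqrt; apply: eq_bigr => i _.
Qed.

Lemma sqrrBN (a b : R) : (- a - - b) ^+ 2 = (a - b) ^+ 2.
Proof. by rewrite -opprD sqrrN. Qed.

Lemma sqrrB2 (c a b : R) : ((c - a) - (c - b)) ^+ 2 = (a - b) ^+ 2.
Proof. by rewrite opprB addrC subrKA -[RHS]sqrrN opprB. Qed.

Lemma half_turn_x_isometry : is_isometry half_turn_x.
Proof.
apply: half_turn_isometry => [p|p q].
  by apply: row3P; rewrite !mxE /= ?opprK ?subKr.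
case=> [[|[|[|//]]] lti]; rewrite !mxE /= ?sqrrBN ?sqrrB2;
  by congr ((p _ _ - q _ _) ^+ 2); apply: val_inj.
Qed.

Lemma half_turn_y_isometry : is_isometry half_turn_y.
Proof.
apply: half_turn_isometry => [p|p q].
  by apply: row3P; rewrite !mxE /= ?opprK ?subKr.
case=> [[|[|[|//]]] lti]; rewrite !mxE /= ?sqrrBN ?sqrrB2;
  by congr ((p _ _ - q _ _) ^+ 2); apply: val_inj.
Qed.

Lemma half_turn_z_isometry : is_isometry half_turn_z.
Proof.
apply: half_turn_isometry => [p|p q].
  by apply: row3P; rewrite !mxE /= ?opprK ?subKr.
case=> [[|[|[|//]]] lti]; rewrite !mxE /= ?sqrrBN ?sqrrB2;
  by congr ((p _ _ - q _ _) ^+ 2); apply: val_inj.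
Qed.

Definition rot_x : isom := Isom (isom_subproof half_turn_x_isometry).
Definition rot_y : isom := Isom (isom_subproof half_turn_y_isometry).
Definition rot_z : isom := Isom (isom_subproof half_turn_z_isometry).

Definition line p v : set (E3 R) := [set p + t *: v | t in [set: R]].

Definition is_line L : Prop := exists p v, v != 0 /\ L = line p v.

Definition parallel_to v L : Prop := exists p, L = line p v.

Definition is_axis_of (g : isom) L : Prop :=
  [/\ is_line L, g != 1%g & forall p, L p -> g p = p].

Definition is_rotation (g : isom) : Prop := exists L, is_axis_of g L.

Definition is_axis_in (G : set isom) L : Prop :=
  exists g, G g /\ is_axis_of g L.

End Euclidean.

Section Subgroups.
Variable gT : groupType.
Implicit Types A G H : set gT.

Definition is_subgroup H : Prop :=
  H 1%g /\ forall x y, H x -> H y -> H (x / y)%g.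

Definition generated A : set gT := smallest is_subgroup A.

(* H has finitely many left cosets in G. *)
Definition finite_index H G : Prop :=
  finite_set [set [set (x * h)%g | h in H] | x in G].

End Subgroups.

Section Rectangles.
Variable R : realType.
Implicit Types (p q : E3 R) (L P : set (E3 R)) (G : set (isom R)).

Definition Uhat : set (isom R) :=
  generated [set g | [\/ g = rot_x R, g = rot_y R | g = rot_z R]].

Definition generated_by_rotations G : Prop :=
  G = generated (G `&` @is_rotation R).

(* Rectangles with sides parallel to the y- and z-axes, given by the corner
   with least coordinates and the two side lengths. *)
Record rectangle := Rectangle { corner : E3 R; ylen : R; zlen : R }.
Implicit Type Q : rectangle.

Definition nondegenerate Q : Prop := 0 < ylen Q /\ 0 < zlen Q.

Definition yside Q : E3 R := ylen Q *: ey R.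
Definition zside Q : E3 R := zlen Q *: ez R.

Definition region Q : set (E3 R) :=
  [set q | exists s t : R, [/\ 0 <= s <= 1, 0 <= t <= 1 &
     q = corner Q + s *: yside Q + t *: zside Q]].

Definition vertices Q : set (E3 R) :=
  [set corner Q; corner Q + yside Q; corner Q + zside Q;
       corner Q + yside Q + zside Q].

Definition lattice_translate Q (m n : int) : rectangle :=
  Rectangle (corner Q + yside Q *~ m + zside Q *~ n) (ylen Q) (zlen Q).

Definition is_tessellation P (T : set rectangle) : Prop :=
  exists Q, [/\ nondegenerate Q,
    T = [set lattice_translate Q mn.1 mn.2 | mn in [set: int * int]] &
    \bigcup_(Q' in T) region Q' = P].

Definition congruent (A B : set (E3 R)) : Prop :=
  exists g : isom R, g @` A = B.

Definition divides_in_half L Q : Prop :=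
  exists Q1 Q2, [/\ nondegenerate Q1, nondegenerate Q2,
    congruent (region Q1) (region Q2),
    region Q1 `|` region Q2 = region Q &
    region Q1 `&` region Q2 = L `&` region Q].

Definition parallel_to_yz_plane P : Prop :=
  exists c : R, P = [set p | p 0 0 = c].

Definition is_axis_point G P p : Prop :=
  exists L, [/\ is_axis_in G L, parallel_to (ex R) L & P `&` L = [set p]].

End Rectangles.

(* Main.v *)
Require Import Defs.
From HB Require Import structures.
From mathcomp Require Import all_boot all_order all_algebra.
From mathcomp Require Import boolp classical_sets functions cardinality reals.
From mathcomp Require Import zify ring lra.

Set Implicit Arguments.
Unset Strict Implicit.
Unset Printing Implicit Defensive.

Import Order.TTheory GRing.Theory Num.Theory.

Local Open Scope classical_set_scope.
Local Open Scope ring_scope.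

(** Every element of [Uhat] has the form
    (x, y, z) |-> (+-x + 2u, +-y + 2v, +-z + 2w) with integers u, v, w, an even
    number of minus signs, and parities of u, v, w tied to the signs
    ([Uhat_diag]).  An element fixing the first coordinate is therefore either a
    translation in the yz-directions or a half-turn about a line parallel to
    the x-axis, and composing one half-turn of the second kind with the
    translations gives all of them.  Write T for the group of those (a, b) such
    that the translation by (0, 2a, 2b) lies in [G]; if (v, w) is one axis
    point, the axis points are exactly the points of (v, w) + T.

    It remains to see that the lattice T is rectangular.  Conjugation by a
    half-turn about an axis in the plane, parallel to the y-axis and at height
    w0, makes T symmetric under (a, b) |-> (a, -b).  Such a lattice could still
    be rhombic (centred rectangular); parities exclude this.  In fact w0 is even
    and axis points have odd height, so reflecting (v, w) in the height w0 shows
    that T contains (0, 2d) with d = w0 - w odd, whereas the second coordinate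
    of every element of T is even.  If (0, 2 be) generates the vertical part of
    T, then be divides d, so be is odd.  For (a, b) in T also (0, 2b) is in T;
    as b is even and be is odd, 2 be divides b, hence (0, b) and (a, 0) lie in T
    ([reflected_lattice_rectangular]).  Finite index is what makes T contain a
    nonzero horizontal vector ([yz_translation_finite_index]).

    The same parity gives the midlines: w0 - w is an odd multiple of be, half
    the height of the rectangles, and translating the axis at height w0 by
    multiples of 2 be puts an axis halfway up every row of rectangles
    ([axis_lattice]). *)

(** * Lattices of integer vectors *)

Lemma int_subgroup_principal (H : int -> Prop) :
  (forall m n, H m -> H n -> H (m - n)) -> (exists2 m, m != 0 & H m) ->
  exists2 g : int, 0 < g & forall m, H m <-> (g %| m)%Z.
Proof.
move=> HB [m0 m0_neq0 Hm0].
have H0 : H 0 by rewrite -(subrr m0); exact: HB.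
have HN m : H m -> H (- m) by rewrite -sub0r; exact: HB.
have HM m k : H m -> H (m * k).
  move=> Hm; have HMn n : H (m * n%:Z).
    elim: n => [|n IHn]; first by rewrite mulr0.
    by rewrite (_ : _ * _ = m * n%:Z - - m); [apply/HB/HN | lia].
  by case: k => n; [exact: HMn | rewrite NegzE mulrN; exact/HN/HMn].
pose Q n := (0 < n)%N && `[< H n%:Z >].
have exQ : exists n, Q n.
  exists `|m0|%N; apply/andP; split; first by rewrite absz_gt0.
  by apply/asboolP; case: (intP m0) Hm0 => // n /HN; rewrite opprK.
case: (ex_minnP exQ) => g /andP[g_gt0 /asboolP Hg] g_min.
exists g%:Z => // m; split=> [Hm|/dvdzP[k ->]]; last by rewrite mulrC; exact: HM.
have Hr : H (m %% g)%Z.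
  by rewrite (_ : (_ %% _)%Z = m - g%:Z * (m %/ g)%Z); [apply/HB/HM | lia].
apply/dvdz_mod0P/eqP; apply: contraT => r_neq0.
have r_ge0 : 0 <= (m %% g)%Z by apply: modz_ge0; lia.
have : Q `|(m %% g)%Z|%N.
  by rewrite /Q absz_gt0 r_neq0; apply/asboolP; rewrite gez0_abs.
by move/g_min; have := @ltz_pmod m g%:Z; lia.
Qed.

(** The oddness of [d] rules out the rhombic lattices, which are the other
    lattices symmetric under a reflection: it forces the generator [2 * be] of
    the vertical part to be twice an odd number, while every second coordinate
    is even. *)
Lemma reflected_lattice_rectangular (T : int -> int -> Prop) (d : int) :
  (forall a b a' b', T a b -> T a' b' -> T (a - a') (b - b')) ->
  (forall a b, T a b -> T a (- b)) ->
  (forall a b, T a b -> (2 %| b)%Z) ->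
  T 0 (2 * d) -> ~~ (2 %| d)%Z -> (exists2 n, n != 0 & T n 0) ->
  exists al be : int, [/\ 0 < al, 0 < be, ~~ (2 %| be)%Z, (be %| d)%Z &
    forall a b, T a b <-> (al %| a)%Z /\ (2 * be %| b)%Z].
Proof.
move=> TB Tsym Tev Td oddd Tn.
have TD a b a' b' : T a b -> T a' b' -> T (a + a') (b + b').
  move=> Tab Tab'; have T00 := TB _ _ _ _ Tab Tab.
  rewrite -[a']opprK -[b']opprK; apply: (TB) => //.
  by have := TB _ _ _ _ T00 Tab'; rewrite !subrr !sub0r.
have [al al_gt0 alP] : exists2 g : int, 0 < g & forall m, T m 0 <-> (g %| m)%Z.
  by apply: int_subgroup_principal => // m n Tm Tn'; rewrite -[0]subr0; exact: TB.
have [g g_gt0 gP] : exists2 g : int, 0 < g & forall m, T 0 m <-> (g %| m)%Z.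
  apply: int_subgroup_principal => [m n Tm Tn'|]; first by rewrite -[0]subr0; exact: TB.
  by exists (2 * d) => //; move: oddd; lia.
have /dvdzP[be gE] : (2 %| g)%Z by apply: (Tev 0); apply/gP.
have /gP/dvdzP[k dE] := Td.
have {}dE : d = k * be by lia.
have be_odd : ~~ (2 %| be)%Z.
  by apply: contra oddd => /dvdzP[j be_eq]; rewrite dE be_eq mulrA dvdz_mull.
exists al, be; split=> //; [by lia | by rewrite dE dvdz_mull |].
move=> a b; rewrite mulrC -gE; split=> [Tab|[/alP Ta /gP Tb]]; last first.
  by rewrite -[a]addr0 -[b]add0r; exact: TD.
(* b + b = m * g with b even and g twice an odd number, so m is even and
   g divides b itself. *)
have /dvdzP[c bE] := Tev _ _ Tab.
have /gP/dvdzP[m mE] : T 0 (b + b).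
  by have := TB _ _ _ _ Tab (Tsym _ _ Tab); rewrite subrr opprK.
have /dvdzP[j mE'] : (2 %| m)%Z.
  have [q beE] : exists q, be = q * 2 + 1 by exists (be %/ 2)%Z; move: be_odd; lia.
  by apply/dvdzP; exists (c - q * m); nia.
have gb : (g %| b)%Z by apply/dvdzP; exists j; nia.
split=> //; apply/alP; rewrite -(subrr b) -[a]subr0.
by apply: (TB) => //; apply/gP.
Qed.

(** * Isometries that are diagonal up to translation *)

Section Subgroups.
Context {gT : groupType} {H : set gT} (subH : is_subgroup H).

Lemma subgroupV x : H x -> H (x^-1)%g.
Proof. by case: subH => H1 Hdiv Hx; rewrite -[(x^-1)%g]mul1g; exact: Hdiv. Qed.

Lemma subgroupM x y : H x -> H y -> H (x * y)%g.
Proof.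
by case: subH => H1 Hdiv Hx Hy; rewrite -[y]invgK; apply/Hdiv/subgroupV.
Qed.

End Subgroups.

Section DiagonalMaps.
Context {R : realType}.
Implicit Types (p q : E3 R) (g h : isom R) (G : set (isom R)).

Lemma pt3_0 (x y z : R) : pt3 x y z 0 0 = x. Proof. by rewrite mxE. Qed.
Lemma pt3_1 (x y z : R) : pt3 x y z 0 1 = y. Proof. by rewrite mxE. Qed.
Lemma pt3_2 (x y z : R) : pt3 x y z 0 2 = z. Proof. by rewrite mxE. Qed.
Definition pt3E := (pt3_0, pt3_1, pt3_2).

Lemma pt3_eta p : pt3 (p 0 0) (p 0 1) (p 0 2) = p.
Proof. by apply: row3P; rewrite pt3E. Qed.

(** The third sign is the one for which the linear part is a rotation.  As v is
    the fixed point of y |-> -y + 2v, the factor 2 makes the parameters of a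
    half-turn the coordinates of its axis. *)
Definition diag_map (s t : bool) (u v w : int) p : E3 R :=
  pt3 ((-1) ^+ s * p 0 0 + 2 * u%:~R) ((-1) ^+ t * p 0 1 + 2 * v%:~R)
      ((-1) ^+ (s (+) t) * p 0 2 + 2 * w%:~R).

Lemma diag_map_comp s t u v w s' t' u' v' w' p :
  diag_map s t u v w (diag_map s' t' u' v' w' p) =
  diag_map (s (+) s') (t (+) t') (u + (-1) ^+ s * u') (v + (-1) ^+ t * v')
    (w + (-1) ^+ (s (+) t) * w') p.
Proof.
by case: s t s' t' => [] [] [] []; apply: row3P; rewrite !pt3E /= ?expr1 ?expr0; ring.
Qed.

Lemma diag_map_inj s t u v w s' t' u' v' w' :
  diag_map s t u v w =1 diag_map s' t' u' v' w' ->
  [/\ s = s', t = t', u = u', v = v' & w = w'].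
Proof.
move=> e.
have e0 i := congr1 (fun q => q 0 i) (e (pt3 0 0 0)).
have e1 i := congr1 (fun q => q 0 i) (e (pt3 1 1 1)).
move: (e0 0) (e0 1) (e0 2) (e1 0) (e1 1); rewrite /diag_map !pt3E !mulr0 !add0r !mulr1.
have two_neq0 : (2 : R) != 0 by rewrite pnatr_eq0.
move=> /(mulfI two_neq0)/intr_inj-> /(mulfI two_neq0)/intr_inj->.
move=> /(mulfI two_neq0)/intr_inj-> /addIr/signr_inj-> /addIr/signr_inj->.
by [].
Qed.

Lemma diag_map0 p : diag_map false false 0 0 0 p = p.
Proof. by rewrite -[RHS]pt3_eta; apply: row3P; rewrite !pt3E; ring. Qed.

Definition contains G s t u v w := exists2 g, G g & g =1 diag_map s t u v w.

Definition half_turn_at_x G v w := contains G false true 0 v w.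
Definition half_turn_at_y G u w := contains G true false u 0 w.
Definition yz_translation G a b := contains G false false 0 a b.

Lemma diag_map_inv s t u v w g : g =1 diag_map s t u v w ->
  (g^-1)%g =1 diag_map s t (- (-1) ^+ s * u) (- (-1) ^+ t * v)
    (- (-1) ^+ (s (+) t) * w).
Proof.
move=> gE p.
rewrite -{1}[p](_ : g (diag_map s t (- (-1) ^+ s * u) (- (-1) ^+ t * v)
    (- (-1) ^+ (s (+) t) * w) p) = p).
  by rewrite -isomME mulVg.
rewrite gE diag_map_comp !addbb -[RHS]diag_map0; congr diag_map;
  by rewrite mulNr mulrN mulrA -signr_addb addbb mul1r subrr.
Qed.

(** Signs do not matter modulo 2, so the classes of u + v and v + w are additive
    under composition, as are the sign bits; hence the two congruences define a
    subgroup, and the three generators satisfy them. *)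
Lemma Uhat_diag g : Uhat g -> exists s t u v w,
  [/\ g =1 diag_map s t u v w, (2 %| u + v - s%:Z)%Z & (2 %| v + w - t%:Z)%Z].
Proof.
move=> Ug; apply: (Ug [set g | _]); split; last first.
  move=> {Ug}g [] ->.
  - exists false, true, 0, 0, 1; split=> // p.
    by apply: row3P; rewrite /= /half_turn_x !pt3E /=; ring.
  - exists true, false, 1, 0, 0; split=> // p.
    by apply: row3P; rewrite /= /half_turn_y !pt3E /=; ring.
  - exists true, true, 0, 1, 0; split=> // p.
    by apply: row3P; rewrite /= /half_turn_z !pt3E /=; ring.
split; first by exists false, false, 0, 0, 0; split=> // p; rewrite diag_map0.
move=> x y [s [t [u [v [w [xE xp xq]]]]]] [s' [t' [u' [v' [w' [yE yp yq]]]]]].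
eexists _, _, _, _, _; split.
- by move=> p; rewrite isomME xE (diag_map_inv yE) diag_map_comp.
- by move: xp yp; case: s s' t t' {xE yE xq yq} => [] [] [] []; rewrite /= ?expr1 ?expr0; lia.
- by move: xq yq; case: s s' t t' {xE yE xp yp} => [] [] [] []; rewrite /= ?expr1 ?expr0; lia.
Qed.

Lemma contains_Uhat G s t u v w : G `<=` @Uhat R -> contains G s t u v w ->
  (2 %| u + v - s%:Z)%Z /\ (2 %| v + w - t%:Z)%Z.
Proof.
move=> GU [g /GU/Uhat_diag[s' [t' [u' [v' [w' [gE p q]]]]]] gE'].
have [x|-> -> -> -> ->] // := @diag_map_inj s t u v w s' t' u' v' w'.
by rewrite -gE'.
Qed.

Section Subgroup.
Context {G : set (isom R)} (subG : is_subgroup G).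

Lemma contains_mul s t u v w s' t' u' v' w' :
  contains G s t u v w -> contains G s' t' u' v' w' ->
  contains G (s (+) s') (t (+) t') (u + (-1) ^+ s * u') (v + (-1) ^+ t * v')
    (w + (-1) ^+ (s (+) t) * w').
Proof.
move=> [g Gg gE] [h Gh hE]; exists (g * h)%g; first exact: subgroupM.
by move=> p; rewrite isomME gE hE diag_map_comp.
Qed.

Lemma contains_inv s t u v w : contains G s t u v w ->
  contains G s t (- (-1) ^+ s * u) (- (-1) ^+ t * v) (- (-1) ^+ (s (+) t) * w).
Proof.
by move=> [g Gg gE]; exists (g^-1)%g; [exact: subgroupV | exact: diag_map_inv].
Qed.

End Subgroup.

End DiagonalMaps.

(** * Axes of rotation *)

Section Axes.
Context {R : realType}.
Implicit Types (p q : E3 R) (L : set (E3 R)) (G : set (isom R)).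

Lemma ex_neq0 : ex R != 0.
Proof.
apply/eqP => /(congr1 (fun q => q 0 0)); rewrite pt3_0 mxE => /eqP.
by rewrite oner_eq0.
Qed.

Lemma ey_neq0 : ey R != 0.
Proof.
apply/eqP => /(congr1 (fun q => q 0 1)); rewrite pt3_1 mxE => /eqP.
by rewrite oner_eq0.
Qed.

(** Used along the direction of an axis, where two points at distance 1 are
    fixed. *)
Lemma signed_fixed2 (s : bool) (u : int) (x : R) :
  (-1) ^+ s * x + 2 * u%:~R = x -> (-1) ^+ s * (x + 1) + 2 * u%:~R = x + 1 ->
  s = false /\ u = 0.
Proof.
case: s; rewrite ?expr1 ?expr0 => e1 e2; first by exfalso; lra.
split=> //; apply/eqP; rewrite -(intr_eq0 R); apply/eqP; lra.
Qed.

Lemma signed_fixed (s : bool) (u : int) (x : R) :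
  (-1) ^+ s * x + 2 * u%:~R = x -> if s then x = u%:~R else u = 0.
Proof.
case: s; rewrite ?expr1 ?expr0 => e1; first lra.
apply/eqP; rewrite -(intr_eq0 R); apply/eqP; lra.
Qed.

Lemma line_ex p : line p (ex R) = [set q | q 0 1 = p 0 1 /\ q 0 2 = p 0 2].
Proof.
apply/seteqP; split=> [_ [t _ <-]|q [q1 q2]] /=; first by rewrite !mxE /= !mulr0 !addr0.
exists (q 0 0 - p 0 0) => //; apply: row3P; rewrite !mxE /= ?mulr0 ?addr0 ?mulr1 //.
by rewrite addrC subrK.
Qed.

Lemma line_ey p : line p (ey R) = [set q | q 0 0 = p 0 0 /\ q 0 2 = p 0 2].
Proof.
apply/seteqP; split=> [_ [t _ <-]|q [q1 q2]] /=; first by rewrite !mxE /= !mulr0 !addr0.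
exists (q 0 1 - p 0 1) => //; apply: row3P; rewrite !mxE /= ?mulr0 ?addr0 ?mulr1 //.
by rewrite addrC subrK.
Qed.

(** Fixing the whole line excludes a sign or a shift in the direction of the
    line.  Of the two remaining forms, the one without signs would be the
    identity, so the element is the half-turn about the line. *)
Lemma x_axis_in G L : G `<=` @Uhat R -> is_axis_in G L -> parallel_to (ex R) L ->
  exists v w, half_turn_at_x G v w /\ L = [set q | q 0 1 = v%:~R /\ q 0 2 = w%:~R].
Proof.
move=> GU [g [Gg [_ g_neq1 g_fix]]] [p Lp].
have [s [t [u [v [w [gE uv vw]]]]]] := Uhat_diag (GU _ Gg).
rewrite line_ex in Lp.
have {}g_fix q : q 0 1 = p 0 1 -> q 0 2 = p 0 2 -> diag_map s t u v w q = q.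
  by move=> qp qp'; rewrite -gE; apply: g_fix; rewrite Lp.
have gp := g_fix p erefl erefl.
have gpx : diag_map s t u v w (p + ex R) = p + ex R.
  by apply: g_fix; rewrite !mxE /= addr0.
have := congr1 (fun q => q 0 0) gpx; rewrite /diag_map pt3_0 !mxE /=.
have := congr1 (fun q => q 0 0) gp; rewrite /diag_map pt3_0 => /signed_fixed2 H {}/H [s0 u0].
have := congr1 (fun q => q 0 1) gp; rewrite /diag_map pt3_1 => /signed_fixed.
have := congr1 (fun q => q 0 2) gp; rewrite /diag_map pt3_2 => /signed_fixed.
rewrite s0 /= ; case: t gE {vw g_fix gp gpx} => gE; rewrite {}s0 {}u0 in gE * => p2 p1.
  by exists v, w; split; [exists g | rewrite Lp p1 p2].
case/eqP: g_neq1; apply: isom_ext => q; rewrite gE p1 p2; exact: diag_map0.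
Qed.

Lemma y_axis_in G L : G `<=` @Uhat R -> is_axis_in G L -> parallel_to (ey R) L ->
  exists u w, half_turn_at_y G u w /\ L = [set q | q 0 0 = u%:~R /\ q 0 2 = w%:~R].
Proof.
move=> GU [g [Gg [_ g_neq1 g_fix]]] [p Lp].
have [s [t [u [v [w [gE uv vw]]]]]] := Uhat_diag (GU _ Gg).
rewrite line_ey in Lp.
have {}g_fix q : q 0 0 = p 0 0 -> q 0 2 = p 0 2 -> diag_map s t u v w q = q.
  by move=> qp qp'; rewrite -gE; apply: g_fix; rewrite Lp.
have gp := g_fix p erefl erefl.
have gpx : diag_map s t u v w (p + ey R) = p + ey R.
  by apply: g_fix; rewrite !mxE /= addr0.
have := congr1 (fun q => q 0 1) gpx; rewrite /diag_map pt3_1 !mxE /=.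
have := congr1 (fun q => q 0 1) gp; rewrite /diag_map pt3_1 => /signed_fixed2 H {}/H [s0 u0].
have := congr1 (fun q => q 0 0) gp; rewrite /diag_map pt3_0 => /signed_fixed.
have := congr1 (fun q => q 0 2) gp; rewrite /diag_map pt3_2 => /signed_fixed.
rewrite s0 addbF; case: s gE {uv g_fix gp gpx} => gE; rewrite {}s0 {}u0 in gE * => p2 p1.
  by exists u, w; split; [exists g | rewrite Lp p1 p2].
case/eqP: g_neq1; apply: isom_ext => q; rewrite gE p1 p2; exact: diag_map0.
Qed.

Lemma diag_map_neq1 s t u v w (g : isom R) :
  g =1 diag_map s t u v w -> s || t -> g != 1%g.
Proof.
move=> gE st; apply/eqP => g1.
have [p|s0 t0 _ _ _] := @diag_map_inj R s t u v w false false 0 0 0.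
  by rewrite -gE g1 isom1E diag_map0.
by rewrite s0 t0 in st.
Qed.

Lemma half_turn_at_x_axis G v w : half_turn_at_x G v w ->
  is_axis_in G (line (pt3 0 v%:~R w%:~R) (ex R)).
Proof.
move=> [g Gg gE]; exists g; split=> //; split.
- by exists (pt3 0 v%:~R w%:~R), (ex R); split=> //; exact: ex_neq0.
- exact: diag_map_neq1 gE _.
move=> p; rewrite line_ex !pt3E => -[p1 p2].
by rewrite gE; apply: row3P; rewrite !pt3E ?p1 ?p2 /=; ring.
Qed.

Lemma half_turn_at_y_axis G u w : half_turn_at_y G u w ->
  is_axis_in G (line (pt3 u%:~R 0 w%:~R) (ey R)).
Proof.
move=> [g Gg gE]; exists g; split=> //; split.
- by exists (pt3 u%:~R 0 w%:~R), (ey R); split=> //; exact: ey_neq0.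
- exact: diag_map_neq1 gE _.
move=> p; rewrite line_ey !pt3E => -[p1 p2].
by rewrite gE; apply: row3P; rewrite !pt3E ?p1 ?p2 /=; ring.
Qed.

Lemma axis_pointE G c q : G `<=` @Uhat R ->
  is_axis_point G [set p | p 0 0 = c] q <->
  exists v w, half_turn_at_x G v w /\ q = pt3 c v%:~R w%:~R.
Proof.
move=> GU; split=> [[L [LG Lx PL]]|[v [w [Gvw ->]]]].
  have [v [w [Gvw Lvw]]] := x_axis_in GU LG Lx.
  have : ([set p : E3 R | p 0 0 = c] `&` L) q by rewrite PL.
  rewrite Lvw => -[/= q0 [q1 q2]]; exists v, w; split=> //.
  by apply: row3P; rewrite pt3E.
exists (line (pt3 0 v%:~R w%:~R) (ex R)); split.
- exact: half_turn_at_x_axis.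
- by exists (pt3 0 v%:~R w%:~R).
rewrite line_ex !pt3E; apply/seteqP; split=> [p [/= p0 [p1 p2]]|p ->] /=.
  by apply: row3P; rewrite pt3E.
by rewrite !pt3E.
Qed.

End Axes.

(** * Translations from finite index *)

(** By pigeonhole two of the cosets [x ^+ n * G] coincide. *)
Lemma finite_index_power (gT : groupType) (G H : set gT) (x : gT) :
  is_subgroup G -> (forall n, H (x ^+ n)%g) -> finite_index G H ->
  exists2 n, (0 < n)%N & G (x ^+ n)%g.
Proof.
move=> [G1 _] Hx finGH.
pose coset n := [set (x ^+ n * h)%g | h in G].
have [m [n [mn e]]] : exists m n, (m < n)%N /\ coset m = coset n.
  apply: contrapT => no_eq; apply: infinite_nat.
  have coset_inj : injective coset.
    move=> m n e; case: (ltngtP m n) => // ltmn; case: no_eq; first by exists m, n.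
    by exists n, m.
  have := finite_preimage (in2W coset_inj) finGH; apply: sub_finite_set.
  by move=> n _; exists (x ^+ n)%g.
have : coset n (x ^+ n)%g by exists 1%g => //; rewrite mulg1.
rewrite -e => -[h Gh xh]; exists (n - m)%N; first by rewrite subn_gt0.
suff -> : (x ^+ (n - m))%g = h by [].
by rewrite -(mulKg (x ^+ m)%g h) xh -(subnKC (ltnW mn)) expgnDr mulKg addKn.
Qed.

Section Translation.
Context {R : realType}.

(** This product of half-turns is the translation by (0, 4, 0). *)
Definition step_y : isom R := (rot_z R * rot_x R * rot_z R * rot_x R)%g.

Lemma Uhat_subgroup : is_subgroup (@Uhat R).
Proof.
split=> [H [[] //]|x y Ux Uy H Hsub]; case: (Hsub) => -[_ Hdiv] _.
by apply: Hdiv; [exact: Ux | exact: Uy].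
Qed.

Lemma step_y_Uhat n : @Uhat R (step_y ^+ n)%g.
Proof.
have Urx : @Uhat R (rot_x R) by move=> H [_]; apply; constructor 1.
have Urz : @Uhat R (rot_z R) by move=> H [_]; apply; constructor 3.
elim: n => [|n IHn]; first exact: (proj1 Uhat_subgroup).
have M := subgroupM Uhat_subgroup.
by rewrite expgS; exact: (M _ _ (M _ _ (M _ _ (M _ _ Urz Urx) Urz) Urx) IHn).
Qed.

Lemma step_y_expE n : (step_y ^+ n)%g =1 diag_map false false 0 (2 * n%:Z) 0.
Proof.
elim: n => [|n IHn] p; first by rewrite diag_map0.
rewrite expgS isomME IHn; apply: row3P;
  by rewrite /= /half_turn_x /half_turn_z /diag_map !pt3E ?intS; ring.
Qed.

Lemma yz_translation_finite_index (G : set (isom R)) :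
  is_subgroup G -> finite_index G (@Uhat R) ->
  exists2 a, a != 0 & yz_translation G a 0.
Proof.
move=> subG finG.
have [n n_gt0 Gn] := finite_index_power subG step_y_Uhat finG.
by exists (2 * n%:Z); [lia | exists (step_y ^+ n)%g => //; exact: step_y_expE].
Qed.

End Translation.

(** * The lattice of axis points *)

Section AxisLattice.
Context {R : realType} (G : set (isom R)).
Hypotheses (subG : is_subgroup G) (GU : G `<=` @Uhat R).

(** Products of a half-turn about an x-axis with the translations of [G]
    identify the axis points with a translate of the translation lattice.
    Conjugation by the half-turn at [w0] provides the reflection symmetry and,
    applied to the axis at [(v, w)], the vertical vector [2 * (w0 - w)]. *)
Lemma axis_lattice c v w w0 :
  half_turn_at_x G v w -> half_turn_at_y G c w0 ->
  (exists2 a, a != 0 & yz_translation G a 0) ->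
  exists al be : int, [/\ 0 < al, 0 < be,
    forall v' w', half_turn_at_x G v' w' <->
      (al %| v' - v)%Z /\ (2 * be %| w' - w)%Z &
    forall n, half_turn_at_y G c (w + be + 2 * be * n)].
Proof.
move=> Xvw Yw0 Tn.
have TB a b a' b' : yz_translation G a b -> yz_translation G a' b' ->
    yz_translation G (a - a') (b - b').
  move=> Tab Tab'; have := contains_mul subG Tab (contains_inv subG Tab').
  by rewrite /= !expr0; congr (contains _ _ _ _ _ _); lia.
have Tsym a b : yz_translation G a b -> yz_translation G a (- b).
  move=> Tab; have := contains_mul subG (contains_mul subG Yw0 Tab) Yw0.
  by rewrite /= ?expr0 ?expr1; congr (contains _ _ _ _ _ _); lia.
have Tev a b : yz_translation G a b -> (2 %| b)%Z.
  by move=> /(contains_Uhat GU)[]; lia.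
have XX a b v' w' : half_turn_at_x G v' w' ->
    half_turn_at_x G a b -> yz_translation G (a - v') (b - w').
  move=> X X'; have := contains_mul subG X' X.
  by rewrite /= ?expr0 ?expr1; congr (contains _ _ _ _ _ _); lia.
have TX a b v' w' : yz_translation G (a - v') (b - w') -> half_turn_at_x G v' w' ->
    half_turn_at_x G a b.
  move=> Tab X; have := contains_mul subG Tab X.
  by rewrite /= ?expr0 ?expr1; congr (contains _ _ _ _ _ _); lia.
have Xrefl : half_turn_at_x G v (2 * w0 - w).
  have := contains_mul subG (contains_mul subG Yw0 Xvw) Yw0.
  by rewrite /= ?expr0 ?expr1; congr (contains _ _ _ _ _ _); lia.
(* Heights of x-axes are odd, and those of y-axes are even. *)
have odd_d : ~~ (2 %| w0 - w)%Z.
  by have := contains_Uhat GU Xvw; have := contains_Uhat GU Yw0; lia.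
have Td : yz_translation G 0 (2 * (w0 - w)).
  by have := XX _ _ _ _ Xvw Xrefl; congr (contains _ _ _ _ _ _); lia.
have [al [be [al0 be0 odd_be /dvdzP[k dE] TE]]] :=
  reflected_lattice_rectangular TB Tsym Tev Td odd_d Tn.
exists al, be; split=> // [v' w'|n].
  by rewrite -TE; split=> [/(XX _ _ _ _ Xvw)|/TX]; last apply.
(* w0 = w + k * be with k odd, so every w + be + 2 * be * n differs from w0 by
   a multiple of the period 2 * be. *)
have /dvdzP[j jE] : (2 %| k - 1)%Z.
  have : ~~ (2 %| k)%Z by apply: contra odd_d => k2; rewrite dE dvdz_mulr.
  by lia.
have Tmid : yz_translation G 0 (w + be + 2 * be * n - w0).
  by apply/TE; split; [exact: dvdz0 | apply/dvdzP; exists (n - j); nia].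
have := contains_mul subG Tmid Yw0.
by rewrite /= ?expr0 ?expr1; congr (contains _ _ _ _ _ _); lia.
Qed.

End AxisLattice.

(** * Rectangles in a plane *)

Section Rectangles.
Context {R : realType}.
Implicit Types (p q : E3 R) (c y z a b : R).

Definition rect c y z a b : rectangle R := Rectangle (pt3 c y z) a b.

Lemma lattice_translate_rect c y z a b m n :
  lattice_translate (rect c y z a b) m n =
  rect c (y + a * m%:~R) (z + b * n%:~R) a b.
Proof.
rewrite /lattice_translate /rect /yside /zside /=; congr Rectangle.
rewrite -!scaler_int; apply: row3P; rewrite !mxE /=; ring.
Qed.

Lemma region_rect c y z a b : 0 < a -> 0 < b ->
  region (rect c y z a b) =
  [set q | [/\ q 0 0 = c, y <= q 0 1 <= y + a & z <= q 0 2 <= z + b]].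
Proof.
move=> a_gt0 b_gt0; apply/seteqP; split=> q /=.
  move=> [s [t [/andP[s0 s1] /andP[t0 t1] ->]]].
  rewrite /yside /zside /= !mxE /=; split; [ring | |]; apply/andP; split; nra.
move=> [q0 /andP[q1 q1'] /andP[q2 q2']].
exists ((q 0 1 - y) / a), ((q 0 2 - z) / b); split.
- by rewrite divr_ge0 ?ler_pdivrMr //=; lra.
- by rewrite divr_ge0 ?ler_pdivrMr //=; lra.
rewrite /yside /zside /= !scalerA !divfK ?gt_eqF //.
by apply: row3P; rewrite !mxE /= ?q0; ring.
Qed.

Lemma vertices_rect c y z a b :
  vertices (rect c y z a b) =
  [set pt3 c y z; pt3 c (y + a) z; pt3 c y (z + b); pt3 c (y + a) (z + b)].
Proof.
rewrite /vertices /yside /zside /=; congr [set _; _; _; _];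
  apply: row3P; rewrite !mxE /=; ring.
Qed.

Lemma rect_tessellation c y z a b : 0 < a -> 0 < b ->
  is_tessellation [set p : E3 R | p 0 0 = c]
    [set lattice_translate (rect c y z a b) mn.1 mn.2 | mn in [set: int * int]].
Proof.
move=> a_gt0 b_gt0; exists (rect c y z a b); split=> //.
apply/seteqP; split=> [q [_ [[m n] _ <-]]|q /= qc].
  by rewrite lattice_translate_rect region_rect // => -[].
pose m := Num.floor ((q 0 1 - y) / a); pose n := Num.floor ((q 0 2 - z) / b).
exists (lattice_translate (rect c y z a b) m n); first by exists (m, n).
rewrite lattice_translate_rect region_rect //=.
have := floor_itv ((q 0 1 - y) / a); have := floor_itv ((q 0 2 - z) / b).
rewrite -/m -/n !ler_pdivlMr // !ltr_pdivrMr // !intrD => /andP[n1 n2] /andP[m1 m2].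
by split=> //; apply/andP; split; lra.
Qed.

Lemma translation_isometry (d : E3 R) : is_isometry (fun p => p + d).
Proof.
split; first by exists (fun p => p - d) => p; rewrite ?addrK ?subrK.
move=> p q; rewrite /edist; congr Num.sqrt; apply: eq_bigr => i _.
by rewrite !mxE opprD addrACA subrr addr0.
Qed.

(** The lower half is carried to the upper half by a vertical translation. *)
Lemma midline_divides_in_half c y z a h : 0 < a -> 0 < h ->
  divides_in_half (line (pt3 c 0 (z + h)) (ey R)) (rect c y z a (2 * h)).
Proof.
move=> a_gt0 h_gt0; have h2_gt0 : 0 < 2 * h by lra.
exists (rect c y z a h), (rect c y (z + h) a h); split=> //.
- exists (Isom (isom_subproof (translation_isometry (pt3 0 0 h)))).
  rewrite !region_rect //; apply/seteqP; split=> [_ [p pQ <-]|p].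
    move: pQ => [p0 p1 /andP[p2 p2']] /=.
    rewrite !mxE /= !addr0; split=> //; apply/andP; split; lra.
  move=> [p0 p1 /andP[p2 p2']].
  exists (p - pt3 0 0 h); last by rewrite /= subrK.
  rewrite /= !mxE /= !subr0; split=> //; apply/andP; split; lra.
- rewrite !region_rect //; apply/seteqP; split=> p /=.
    by case=> -[p0 p1 /andP[p2 p2']]; split=> //; apply/andP; split; lra.
  move=> [p0 p1 /andP[p2 p2']]; have [le|le] := leP (p 0 2) (z + h); [left|right];
    by split=> //; apply/andP; split; lra.
rewrite !region_rect // line_ey !pt3E; apply/seteqP; split=> p /=.
  move=> [[p0 p1 /andP[p2 p2']] [_ _ /andP[p3 p3']]].
  by split; split=> //; [lra | apply/andP; split; lra].
move=> [[_ e] [p0 p1 _]]; split; split=> //; apply/andP; split; lra.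
Qed.

End Rectangles.

(** * The rectangle theorem *)

Theorem proposition4 (R : realType) (G : set (isom R)) (P : set (E3 R))
    (subG : is_subgroup G) (sGU : G `<=` @Uhat R)
    (finG : finite_index G (@Uhat R))
    (genG : generated_by_rotations G)
    (axis_x : exists L, is_axis_in G L /\ parallel_to (ex R) L)
    (axis_y : exists L, is_axis_in G L /\ parallel_to (ey R) L)
    (planeP : parallel_to_yz_plane P)
    (axisP : exists L,
       [/\ is_axis_in G L, parallel_to (ey R) L & L `<=` P]) :
  exists T : set (rectangle R),
    [/\ is_tessellation P T,
        [set p | is_axis_point G P p] = \bigcup_(Q in T) vertices Q &
        forall Q, T Q -> exists L,
          [/\ is_axis_in G L, parallel_to (ey R) L & divides_in_half L Q]].
Proof.
have [c' PE] := planeP; subst P.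
have [L [LG Ly LP]] := axisP.
have [c [w0 [Yw0 LE]]] := y_axis_in sGU LG Ly.
have {c' LP axisP planeP LE LG Ly} <- : c%:~R = c'.
  have := LP (pt3 c%:~R 0 w0%:~R); rewrite LE /= !pt3E.
  exact.
have [L' [LG' Lx]] := axis_x.
have [v [w [Xvw _]]] := x_axis_in sGU LG' Lx.
have [al [be [al_gt0 be_gt0 XE Ymid]]] :=
  axis_lattice subG sGU Xvw Yw0 (yz_translation_finite_index subG finG).
have alR : 0 < al%:~R :> R by rewrite ltr0z.
have beR : 0 < be%:~R :> R by rewrite ltr0z.
have be2R : 0 < 2 * be%:~R :> R by lra.
pose Q0 := rect c%:~R v%:~R w%:~R al%:~R (2 * be%:~R) : rectangle R.
exists [set lattice_translate Q0 mn.1 mn.2 | mn in [set: int * int]]; split.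
- exact: rect_tessellation.
- have XptE m n : half_turn_at_x G (v + al * m) (w + 2 * be * n).
    by apply/XE; split; apply/dvdzP; [exists m | exists n]; ring.
  (* The upper and right vertices of the rectangle (m, n) are least corners of
     neighbouring rectangles. *)
  have vertexE m n y z : y = (v + al * m)%:~R -> z = (w + 2 * be * n)%:~R ->
      is_axis_point G [set p : E3 R | p 0 0 = c%:~R] (pt3 c%:~R y z).
    move=> -> ->; apply/(axis_pointE _ _ sGU).
    by exists (v + al * m), (w + 2 * be * n); split; [exact: XptE|].
  apply/seteqP; split=> [p /(axis_pointE _ _ sGU)[v' [w' [X ->]]]|p].
    have [/dvdzP[m mE] /dvdzP[n nE]] := (XE _ _).1 X.
    exists (lattice_translate Q0 m n); first by exists (m, n).
    rewrite lattice_translate_rect vertices_rect; left; left; left.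
    have -> : v' = v + al * m by lia.
    have -> : w' = w + 2 * be * n by lia.
    by apply: row3P; rewrite !pt3E ?rmorphD ?rmorphM.
  move=> [_ [[m n] _ <-]]; rewrite lattice_translate_rect vertices_rect /=.
  case=> [[[->|->]|->]|->];
    [apply: (vertexE m n) | apply: (vertexE (m + 1) n) |
     apply: (vertexE m (n + 1)) | apply: (vertexE (m + 1) (n + 1))]; ring.
move=> _ [[m n] _ <-] /=.
exists (line (pt3 c%:~R 0 (w + be + 2 * be * n)%:~R) (ey R)); split.
- exact: half_turn_at_y_axis.
- by eexists.
rewrite lattice_translate_rect.
rewrite (_ : (_ + _)%:~R = w%:~R + 2 * be%:~R * n%:~R + be%:~R); last by ring.
exact: midline_divides_in_half.
Qed.
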